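(* Let $m_1\leqslant\dots\leqslant m_r$ be positive integers and suppose there are finite multisets $V_+$ and $V_-$ of positive integers such that $$\sum_{i=1}^r q^{m_i}=\frac{q\prod_{v\in V_+}(1-q^v)}{\prod_{v\in V_-}(1-q^v)}.$$ Fix a positive integer $p$ and define $\gamma_0(=1),\gamma_1,\gamma_2,\ldots$ by the formal power series identity $$\sum_{n=0}^\infty\gamma_nt^n=\frac{\prod_{v\in V_-}(1-vt)}{\prod_{v\in V_+}(1-vt)}\left(\frac{1+pt}{1-pt}\right)^{1/p},$$ where the $p$th root is the formal power series with constant term $1$. Then for every integer $n\geqslant0$, $$\sum_{i=1}^r m_i^{\,n}=n!\,r\,\operatorname{Td}_n(\gamma_1,\dots,\gamma_n).$$
   Context: For $n\geqslant 0$, the $n$th Todd polynomial $\operatorname{Td}_n(c_1,\dots,c_n)\in\mathbb{Q}[c_1,\dots,c_n]$ is defined by: in the ring of symmetric functions in variables $x_1,x_2,\ldots$, with $e_i$ the $i$th elementary symmetric function, $\sum_{n\geqslant0}\operatorname{Td}_n(e_1,\dots,e_n)\,t^n=\prod_{j\geqslant1}\frac{x_jt}{1-e^{-x_jt}}$. Products over multisets are taken with multiplicity. *)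

(* Defs.v *)
From HB Require Import structures.
From mathcomp Require Import all_boot all_order all_algebra.
From mathcomp Require Import boolp.
From mathcomp Require Import mpoly.
Set Implicit Arguments.
Unset Strict Implicit.
Unset Printing Implicit Defensive.
Import GRing.Theory Num.Theory.
Local Open Scope ring_scope.

Record fps (R : Type) := Fps { fps_coef :> nat -> R }.

Notation "{ 'fps' R }" := (fps R) (at level 0, format "{ 'fps'  R }") : type_scope.

HB.instance Definition _ (R : Type) := gen_eqMixin {fps R}.
HB.instance Definition _ (R : Type) := gen_choiceMixin {fps R}.

Lemma fpsP (R : Type) (f g : {fps R}) : f =1 g -> f = g.
Proof. by case: f g => [f] [g] /= /funext ->. Qed.

Section Ring.
Variable R : comNzRingType.
Implicit Types f g h : {fps R}.

Definition fps_zero : {fps R} := Fps (fun=> 0).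
Definition fps_one : {fps R} := Fps (fun n => (n == 0)%:R).
Definition fps_opp f : {fps R} := Fps (fun n => - f n).
Definition fps_add f g : {fps R} := Fps (fun n => f n + g n).
Definition fps_mul f g : {fps R} :=
  Fps (fun n => \sum_(i < n.+1) f i * g (n - i)%N).

Fact fps_addA : associative fps_add.
Proof. by move=> f g h; apply/fpsP => n /=; rewrite addrA. Qed.
Fact fps_addC : commutative fps_add.
Proof. by move=> f g; apply/fpsP => n /=; rewrite addrC. Qed.
Fact fps_add0 : left_id fps_zero fps_add.
Proof. by move=> f; apply/fpsP => n /=; rewrite add0r. Qed.
Fact fps_addN : left_inverse fps_zero fps_opp fps_add.
Proof. by move=> f; apply/fpsP => n /=; rewrite addNr. Qed.

HB.instance Definition _ :=
  GRing.isZmodule.Build {fps R} fps_addA fps_addC fps_add0 fps_addN.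

Let trunc n f : {poly R} := \poly_(i < n.+1) f i.

Let mul_truncE n f g k : (k <= n)%N -> fps_mul f g k = (trunc n f * trunc n g)`_k.
Proof.
move=> kn; rewrite /= coefM; apply: eq_bigr => i _.
have ik : (i <= k)%N by rewrite -ltnS.
by rewrite !coef_poly !ltnS (leq_trans ik kn) (leq_trans (leq_subr _ _) kn).
Qed.

Fact fps_mulC : commutative fps_mul.
Proof. by move=> f g; apply/fpsP => n; rewrite !(mul_truncE _ _ (leqnn n)) mulrC. Qed.

Fact fps_mulA : associative fps_mul.
Proof.
move=> f g h; apply/fpsP => n.
transitivity ((trunc n f * (trunc n g * trunc n h))`_n).
  rewrite coefM; apply: eq_bigr => i _.
  have ik : (i <= n)%N by rewrite -ltnS.
  by rewrite (mul_truncE g h (leq_subr i n)) coef_poly ltnS ik.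
rewrite mulrA coefM; apply: eq_bigr => i _.
have ik : (i <= n)%N by rewrite -ltnS.
by rewrite (mul_truncE f g ik) [(trunc n h)`__]coef_poly ltnS leq_subr.
Qed.

Fact fps_mul1 : left_id fps_one fps_mul.
Proof.
move=> f; apply/fpsP => n /=.
rewrite big_ord_recl /= mul1r subn0 big1 ?addr0 // => i _.
by rewrite mul0r.
Qed.

Fact fps_mulD : left_distributive fps_mul fps_add.
Proof.
move=> f g h; apply/fpsP => n /=.
by rewrite -big_split; apply: eq_bigr => i _ /=; rewrite mulrDl.
Qed.

Fact fps_one_neq0 : fps_one != 0.
Proof. by apply/eqP => /(congr1 (fun f : {fps R} => f 0)) /eqP; rewrite oner_eq0. Qed.

HB.instance Definition _ := GRing.Zmodule_isComNzRing.Build {fps R}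
  fps_mulA fps_mulC fps_mul1 fps_mulD fps_one_neq0.

Definition fpsX : {fps R} := Fps (fun n => (n == 1)%:R).

Lemma fps0E n : (0 : {fps R}) n = 0. Proof. by []. Qed.
Lemma fps1E n : (1 : {fps R}) n = (n == 0)%:R. Proof. by []. Qed.
Lemma fpsNE f n : (- f) n = - f n. Proof. by []. Qed.
Lemma fpsDE f g n : (f + g) n = f n + g n. Proof. by []. Qed.
Lemma fpsME f g n : (f * g) n = \sum_(i < n.+1) f i * g (n - i)%N. Proof. by []. Qed.

Lemma fps_sumE (I : Type) (r : seq I) (P : pred I) (F : I -> {fps R}) n :
  (\sum_(i <- r | P i) F i) n = \sum_(i <- r | P i) F i n.
Proof. by elim/big_rec2: _ => // i y1 y2 _ <-. Qed.

Lemma fpsM0 f g : (f * g) 0%N = f 0%N * g 0%N.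
Proof. by rewrite fpsME big_ord1. Qed.

Lemma fpsMX f n : (f * fpsX) n = if n is k.+1 then f k else 0.
Proof.
case: n => [|n]; first by rewrite fpsM0 mulr0.
rewrite fpsME !big_ord_recr /= subnn mulr0 addr0 subSn // subnn mulr1.
rewrite big1 ?add0r // => i _.
by rewrite subSn ?(ltnW (ltn_ord i)) // eqSS subn_eq0 leqNgt ltn_ord mulr0.
Qed.

End Ring.

Arguments fpsX {R}.

Section Unit.
Variable R : comUnitRingType.
Implicit Types f g : {fps R}.

(* coefficients of 1/f in degrees n-1, ..., 0, in this order *)
Fixpoint fps_inv_rev f n : seq R :=
  if n is k.+1 then
    let s := fps_inv_rev f k in
    (f 0%N)^-1 * ((k == 0)%:R - \sum_(i < k) f i.+1 * s`_i) :: s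
  else [::].

Definition fps_unit f := f 0%N \is a GRing.unit.
Definition fps_inv f : {fps R} :=
  if fps_unit f then Fps (fun n => (fps_inv_rev f n.+1)`_0) else f.

Let nth_inv_rev f n i : (i < n)%N ->
  (fps_inv_rev f n)`_i = (fps_inv_rev f (n - i))`_0.
Proof. by elim: n i => // n IH [|i] // /IH. Qed.

Fact fps_mulV : {in fps_unit, left_inverse 1 fps_inv *%R}.
Proof.
move=> f uf; rewrite mulrC; apply/fpsP => n.
have E k : fps_inv f k = (fps_inv_rev f k.+1)`_0 by rewrite /fps_inv [fps_unit f]uf.
rewrite fpsME big_ord_recl fps1E subn0 E /= mulrA divrr // mul1r.
rewrite -[RHS](subrK (\sum_(i < n) f i.+1 * (fps_inv_rev f n)`_i)); congr (_ + _).
apply: eq_bigr => i _; congr (_ * _); rewrite E [RHS]nth_inv_rev //.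
by rewrite /bump add1n -subSn // subSS.
Qed.

Fact fps_unitP f g : g * f = 1 -> fps_unit f.
Proof.
move=> /(congr1 (fun h : {fps R} => h 0%N)); rewrite fpsM0 => gf.
by apply/unitrPr; exists (g 0%N); rewrite mulrC.
Qed.

Fact fps_inv_out : {in [predC fps_unit], fps_inv =1 id}.
Proof. by move=> f /negbTE nf; rewrite /fps_inv [fps_unit f]nf. Qed.

HB.instance Definition _ := GRing.ComNzRing_hasMulInverse.Build {fps R}
  fps_mulV fps_unitP fps_inv_out.

Lemma fps_unitE f : (f \is a GRing.unit) = (f 0%N \is a GRing.unit).
Proof. by []. Qed.

End Unit.

Section Root.
Implicit Types f g h : {fps rat}.

Let eq_upto n g h := forall k, (k <= n)%N -> g k = h k.

Let eq_uptoM n g h g' h' : eq_upto n g g' -> eq_upto n h h' ->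
  eq_upto n (g * h) (g' * h').
Proof.
move=> gg hh k kn; rewrite !fpsME; apply: eq_bigr => i _; rewrite gg ?hh //.
  by rewrite (leq_trans (leq_subr _ _)).
by rewrite (leq_trans _ kn) // -ltnS.
Qed.

Let eq_uptoX n p g h : eq_upto n g h -> eq_upto n (g ^+ p) (h ^+ p).
Proof. by move=> gh; elim: p => [|p IH]; rewrite ?expr0 // !exprS; apply: eq_uptoM. Qed.

Let expf0 p g : g 0%N = 1 -> (g ^+ p) 0%N = 1.
Proof. by move=> g0; elim: p => [|p IH]; rewrite ?expr0 // exprS fpsM0 g0 IH mulr1. Qed.

Let mulS n g h : g 0%N = 1 -> h 0%N = 1 ->
  (g * h) n.+1 = g n.+1 + h n.+1 + \sum_(i < n) g i.+1 * h (n - i)%N.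
Proof.
move=> g0 h0; rewrite fpsME big_ord_recr big_ord_recl /= subn0 subnn g0 h0 mul1r mulr1.
by rewrite addrC addrA.
Qed.

Let rootS n p g h : g 0%N = 1 -> h 0%N = 1 -> eq_upto n g h ->
  (g ^+ p) n.+1 - (h ^+ p) n.+1 = p%:R * (g n.+1 - h n.+1).
Proof.
move=> g0 h0 gh; elim: p => [|p IH]; first by rewrite !expr0 subrr mul0r.
rewrite !exprS !mulS ?expf0 //.
set a := \sum_(i < n) _; set b := \sum_(i < n) _.
have -> : a = b.
  by apply: eq_bigr => i _; rewrite gh // (eq_uptoX _ gh) // leq_subr.
rewrite -natr1 mulrDl -IH mul1r opprD addrACA subrr addr0.
by rewrite opprD addrACA addrC.
Qed.

Lemma fps_root_unique p g h : (0 < p)%N -> g 0%N = 1 -> h 0%N = 1 ->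
  g ^+ p = h ^+ p -> g = h.
Proof.
move=> p0 g0 h0 E; suff gh n : eq_upto n g h by apply/fpsP => n; apply: (gh n).
elim: n => [|n IH] k; first by rewrite leqn0 => /eqP ->; rewrite g0.
rewrite leq_eqVlt => /predU1P[->|]; last exact: IH.
have /esym/eqP := rootS p g0 h0 IH; rewrite E subrr mulf_eq0 pnatr_eq0.
by rewrite -[p == _]negbK -lt0n p0 /= subr_eq0 => /eqP.
Qed.

Lemma fps_root_exists p f : (0 < p)%N -> f 0%N = 1 ->
  exists2 g : {fps rat}, g 0%N = 1 & g ^+ p = f.
Proof.
move=> p0 f0.
pose step n h : {fps rat} :=
  Fps (fun k => h k + ((f n.+1 - (h ^+ p) n.+1) / p%:R) *+ (k == n.+1)).
pose G := fix G n : {fps rat} := if n is k.+1 then step k (G k) else 1.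
have G0 n : G n 0%N = 1 by elim: n => //= n ->; rewrite addr0.
have GS n : eq_upto n (G n.+1) (G n).
  by move=> k kn /=; rewrite (ltn_eqF (kn : (k < n.+1)%N)) addr0.
have Gp n : eq_upto n (G n ^+ p) f.
  elim: n => [|n IH] k; first by rewrite leqn0 => /eqP ->; rewrite f0 expf0.
  rewrite leq_eqVlt => /predU1P[->|kn]; last by rewrite (eq_uptoX _ (GS n)) ?IH.
  have := rootS p (G0 n.+1) (G0 n) (GS n).
  have -> : G n.+1 n.+1 - G n n.+1 = (f n.+1 - (G n ^+ p) n.+1) / p%:R.
    by rewrite /= eqxx mulr1n addrC addKr.
  rewrite mulrC divfK ?pnatr_eq0 -?lt0n //.
  by move/eqP; rewrite (inj_eq (addIr _)) => /eqP.
have Gm n k : (k <= n)%N -> G n k = G k k.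
  elim: n => [|n IH]; first by rewrite leqn0 => /eqP ->.
  rewrite leq_eqVlt => /predU1P[->//|kn]; by rewrite GS ?IH.
exists (Fps (fun n => G n n)); first exact: G0.
apply/fpsP => n; rewrite -(Gp n n) //; apply: eq_uptoX (leqnn n) => k kn /=.
by rewrite Gm.
Qed.

End Root.

Section Todd.

(* e^-t *)
Definition fps_expN : {fps rat} := Fps (fun n => (-1) ^+ n / n`!%:R).

(* The series f(x t), for f in Q[[t]] *)
Definition fps_dilate N (x : {mpoly rat[N]}) (f : {fps rat}) : {fps {mpoly rat[N]}} :=
  Fps (fun n => f n *: x ^+ n).

(* t / (1 - e^-t), as the inverse of (1 - e^-t) / t, whose constant term is 1 *)
Definition todd_series : {fps rat} := (Fps (fun n => (1 - fps_expN) n.+1))^-1.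

Lemma todd_seriesE : todd_series * (1 - fps_expN) = fpsX.
Proof.
set g : {fps rat} := Fps (fun n => (1 - fps_expN) n.+1).
have -> : 1 - fps_expN = g * fpsX.
  by apply/fpsP => -[|n]; rewrite fpsMX.
by rewrite mulrA mulVr ?mul1r.
Qed.

Definition elem_sym n N : n.-tuple {mpoly rat[N]} :=
  [tuple mesym N rat i.+1 | i < n].

(* An identity between symmetric functions in x_1, x_2, ... is an identity
   between symmetric polynomials in x_1, ..., x_N for every N. *)
Definition is_todd n (P : {mpoly rat[n]}) :=
  forall N, P \mPo (elem_sym n N) = (\prod_(j < N) fps_dilate 'X_j todd_series) n.

Definition fps_euler (A : comNzRingType) (f : {fps A}) : {fps A} := Fps (fun n => f n *+ n).

Lemma fps_eulerM (A : comNzRingType) (f g : {fps A}) :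
  fps_euler (f * g) = fps_euler f * g + f * fps_euler g.
Proof.
apply/fpsP => n; rewrite fpsDE !fpsME /= -sumrMnl -big_split; apply: eq_bigr => i _ /=.
by rewrite mulrnAl mulrnAr -mulrnDr subnKC // -ltnS.
Qed.

Section Variables.
Variable N : nat.
Implicit Type x : {mpoly rat[N]}.

Lemma fps_dilateM x f g : fps_dilate x (f * g) = fps_dilate x f * fps_dilate x g.
Proof.
apply/fpsP => n; rewrite fpsME /= scaler_suml; apply: eq_bigr => i _.
by rewrite -scalerAl -scalerAr scalerA -exprD subnKC // -ltnS.
Qed.

Lemma fps_euler_dilate x f : fps_euler (fps_dilate x f) = fps_dilate x (fps_euler f).
Proof. by apply/fpsP => n /=; rewrite scalerMnl. Qed.

Definition fps_dlog (f : {fps rat}) : {fps rat} := fps_euler f / f.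

Lemma fps_euler_prod (f : {fps rat}) (s : seq 'I_N) : f 0%N = 1 ->
  fps_euler (\prod_(j <- s) fps_dilate 'X_j f) =
  (\prod_(j <- s) fps_dilate 'X_j f) * \sum_(j <- s) fps_dilate 'X_j (fps_dlog f).
Proof.
move=> f0; elim: s => [|j s IH].
  rewrite !big_nil mulr0; apply/fpsP => n; rewrite fps0E /=.
  by case: n => [|n]; rewrite ?mulr0n ?mul0rn.
rewrite !big_cons fps_eulerM IH fps_euler_dilate.
have -> : fps_euler f = fps_dlog f * f by rewrite divrK // fps_unitE f0 unitr1.
by rewrite fps_dilateM mulrDr; congr (_ + _); rewrite ?mulrA // [RHS]mulrC mulrA.
Qed.

Definition psum k : {mpoly rat[N]} := \sum_(j < N) 'X_j ^+ k.

Lemma prod_dilate_rec (f : {fps rat}) n : f 0%N = 1 ->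
  let F := \prod_(j < N) fps_dilate 'X_j f in
  F n *+ n = \sum_(i < n) fps_dlog f (n - i)%N *: (F i * psum (n - i)%N).
Proof.
move=> f0 F.
have psi0 : fps_dlog f 0%N = 0 by rewrite fpsM0 [fps_euler f 0%N]mulr0n mul0r.
have := fps_euler_prod (index_enum 'I_N) f0.
move=> /(congr1 (fun h : {fps _} => h n)) E; rewrite -[LHS]/(fps_euler F n) E {E}.
have S k : (\sum_(j < N) fps_dilate 'X_j (fps_dlog f)) k = fps_dlog f k *: psum k.
  by rewrite fps_sumE scaler_sumr.
rewrite [LHS]fpsME big_ord_recr [nat_of_ord ord_max]/= subnn S psi0 scale0r mulr0 [LHS]addr0.
by apply: eq_bigr => i _; rewrite S scalerAr.
Qed.

Lemma prod_dilate_X (s : seq 'I_N) n :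
  (\prod_(j <- s) fps_dilate 'X_j fpsX) n =
  (\prod_(j <- s) 'X_j) *+ (n == size s) :> {mpoly rat[N]}.
Proof.
elim: s n => [|j s IH] n; first by rewrite !big_nil fps1E.
have MX (f : {fps {mpoly rat[N]}}) m :
    (fps_dilate 'X_j fpsX * f) m = if m is k.+1 then 'X_j * f k else 0.
  case: m => [|m]; first by rewrite fpsM0 /= scale0r mul0r.
  rewrite fpsME big_ord_recl /= scale0r mul0r add0r big_ord_recl /=.
  rewrite scale1r expr1 big1 ?addr0 ?subSS ?subn0 // => i _.
  by rewrite /= scale0r mul0r.
rewrite !big_cons MX; case: n => [|n] //=.
by rewrite IH eqSS mulrnAr.
Qed.

Lemma prod_dilate_1X n :
  (\prod_(j < N) fps_dilate 'X_j (1 + fpsX)) n = mesym N rat n.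
Proof.
have E (j : 'I_N) : fps_dilate 'X_j (1 + fpsX) = fps_dilate 'X_j fpsX + 1.
  apply/fpsP => k; rewrite fpsDE addrC /= scalerDl; congr (_ + _).
  by case: k => [|k]; rewrite ?scale0r // scale1r.
rewrite (eq_bigr _ (fun j _ => E j)) bigA_distr /= fps_sumE /mesym.
rewrite [RHS]big_mkcond; apply: eq_bigr => J _.
rewrite -big_mkcond /= -big_enum prod_dilate_X -cardE eq_sym big_enum /=.
by case: eqP => _; rewrite ?mulr1n.
Qed.

Lemma mesym_rec n :
  mesym N rat n *+ n =
  \sum_(i < n) fps_dlog (1 + fpsX) (n - i)%N *: (mesym N rat i * psum (n - i)%N).
Proof.
rewrite -prod_dilate_1X prod_dilate_rec; last by rewrite fpsDE fps1E addr0.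
by apply: eq_bigr => i _; rewrite prod_dilate_1X.
Qed.

End Variables.

Lemma fps_dlog_1X k : fps_dlog (1 + fpsX) k.+1 = (-1) ^+ k.
Proof.
have E : fps_dlog (1 + fpsX) * (1 + fpsX) = fpsX.
  rewrite divrK ?fps_unitE ?fpsDE ?fps1E ?addr0 ?unitr1 //.
  apply/fpsP => n; rewrite -[LHS]/((1 + fpsX : {fps rat}) n *+ n) fpsDE fps1E.
  by case: n => [|[|n]]; rewrite /= ?add0r ?mulr0n ?mulr1n ?mul0rn.
have {}E n : fps_dlog (1 + fpsX) n.+1 + fps_dlog (1 + fpsX) n = (n == 0)%:R.
  by rewrite -[RHS]/((fpsX : {fps rat}) n.+1) -{3}E mulrDr mulr1 fpsDE fpsMX.
elim: k => [|k IH].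
  by rewrite -[LHS](addrK (fps_dlog (1 + fpsX) 0%N)) E fpsM0 [fps_euler _ 0%N]mulr0n mul0r subr0.
by rewrite -[LHS](addrK (fps_dlog (1 + fpsX) k.+1)) E IH sub0r exprS mulN1r.
Qed.

Lemma todd_series0 : todd_series 0%N = 1.
Proof.
have := congr1 (fun f : {fps rat} => f 1%N) todd_seriesE.
rewrite fpsME big_ord_recl big_ord1 !fpsDE !fpsNE !fps1E => E.
by rewrite -[RHS]E -[LHS]mulr1 -[LHS]addr0; congr (_ * _ + _); rewrite mulr0.
Qed.

Section Existence.
Variable M : nat.

Let expr (a : forall N, {mpoly rat[N]}) :=
  exists P : {mpoly rat[M]}, forall N, P \mPo elem_sym M N = a N.

Let expr1 : expr (fun=> 1).
Proof. by exists 1 => N; rewrite comp_mpoly1. Qed.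

Let exprZ c a : expr a -> expr (fun N => c *: a N).
Proof. by case=> P HP; exists (c *: P) => N; rewrite comp_mpolyZ HP. Qed.

Let exprM a b : expr a -> expr b -> expr (fun N => a N * b N).
Proof. by case=> P HP [Q HQ]; exists (P * Q) => N; rewrite rmorphM /= HP HQ. Qed.

Let exprB a b : expr a -> expr b -> expr (fun N => a N - b N).
Proof. by case=> P HP [Q HQ]; exists (P - Q) => N; rewrite comp_mpolyB HP HQ. Qed.

Let expr_sum n (a : nat -> forall N, {mpoly rat[N]}) :
  (forall i, (i < n)%N -> expr (a i)) -> expr (fun N => \sum_(i < n) a i N).
Proof.
elim: n => [|n IH] H.
  by exists 0 => N; rewrite big_ord0 comp_mpoly0.
have [P HP] : expr (fun N => \sum_(i < n) a i N).
  by apply: IH => i ni; apply: H; rewrite ltnS ltnW.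
have [Q HQ] := H n (ltnSn n).
by exists (P + Q) => N; rewrite comp_mpolyD HP HQ big_ord_recr.
Qed.

Let expr_eq a b : (forall N, a N = b N) -> expr a -> expr b.
Proof. by move=> ab [P HP]; exists P => N; rewrite HP ab. Qed.

Let expr_mesym k : (k <= M)%N -> expr (fun N => mesym N rat k).
Proof.
case: k => [|k] kM; first by apply: expr_eq expr1 => N; rewrite mesym0E.
exists 'X_(Ordinal kM) => N.
by rewrite comp_mpolyXU -tnth_nth tnth_mktuple.
Qed.

Let expr_psum k : (0 < k <= M)%N -> expr (fun N => psum N k).
Proof.
elim/ltn_ind: k => -[//|k] IH /andP[_ kM].
pose d n := fps_dlog (1 + fpsX) n.
have H1 : expr (fun N => \sum_(i < k) d (k - i)%N *: (mesym N rat i.+1 * psum N (k - i)%N)).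
  apply: (@expr_sum k (fun i N => d (k - i)%N *: (mesym N rat i.+1 * psum N (k - i)%N))).
  move=> i ik; apply/exprZ/exprM.
    by apply: expr_mesym; apply: leq_trans kM; apply: ltnW.
  by apply: IH; rewrite ?ltnS ?leq_subr // subn_gt0 ik (leq_trans (leq_subr _ _)) // ltnW.
have H2 := exprZ ((-1) ^+ k) (exprB (exprZ k.+1%:R (expr_mesym kM)) H1).
apply: expr_eq H2 => N.
rewrite scaler_nat mesym_rec big_ord_recl subn0 mesym0E mul1r fps_dlog_1X addrK.
by rewrite scalerA -expr2 sqrr_sign scale1r.
Qed.

Let expr_prod (f : {fps rat}) k : f 0%N = 1 -> (k <= M)%N ->
  expr (fun N => (\prod_(j < N) fps_dilate 'X_j f) k).
Proof.
move=> f0; elim/ltn_ind: k => -[|k] IH kM.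
  apply: expr_eq expr1 => N; elim/big_rec: _ => [|j F _ E]; first by rewrite fps1E.
  by rewrite fpsM0 -E /= f0 scale1r mulr1.
pose a i N := fps_dlog f (k.+1 - i)%N *:
  ((\prod_(j < N) fps_dilate 'X_j f) i * psum N (k.+1 - i)%N).
have H : expr (fun N => \sum_(i < k.+1) a i N).
  apply: expr_sum => i ik; apply/exprZ/exprM; first by apply: IH => //; apply: ltnW; apply: leq_trans kM.
  by apply: expr_psum; rewrite subn_gt0 ik (leq_trans (leq_subr _ _)).
apply: expr_eq (exprZ k.+1%:R^-1 H) => N; rewrite -prod_dilate_rec //.
by rewrite -scaler_nat scalerA mulVf ?scale1r // pnatr_eq0.
Qed.

Lemma todd_exists : exists P : {mpoly rat[M]}, is_todd P.
Proof. exact: expr_prod todd_series0 (leqnn M). Qed.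

Lemma todd_unique (P Q : {mpoly rat[M]}) : is_todd P -> is_todd Q -> P = Q.
Proof. by move=> HP HQ; apply: msym_fundamental_un; rewrite HP HQ. Qed.

End Existence.

Definition todd n : {mpoly rat[n]} := projT1 (cid (todd_exists n)).

Lemma toddP n : is_todd (todd n).
Proof. exact: projT2 (cid (todd_exists n)). Qed.

End Todd.

(* Main.v *)
Require Import Defs.
From HB Require Import structures.
From mathcomp Require Import all_boot all_order all_algebra.
From mathcomp Require Import mpoly.
From mathcomp Require Import perm ring.
Set Implicit Arguments.
Unset Strict Implicit.
Unset Printing Implicit Defensive.
Import GRing.Theory Num.Theory.
Local Open Scope ring_scope.

(** Substituting q = e^t turns the hypothesis into
      sum_i e^(m_i t) = e^t prod_(V+) (1 - e^(vt)) / prod_(V-) (1 - e^(vt)),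
    and 1 - e^(vt) = - vt / T(-vt) for T(t) = t / (1 - e^-t).  Since the left
    side has constant term r <> 0, the powers of t cancel and the sum is, up to a
    constant, e^t prod_(V-) T(-vt) / prod_(V+) T(-vt).  On the other side
    c |-> sum_n Td_n(c) t^n is multiplicative and sends 1 + at to T(at), so
    gamma is sent to the same product: the p-th root goes to
    (T(pt) / T(-pt))^(1/p) = e^t because T(t) = e^t T(-t).
    Multiplicativity is expressed by logarithmic derivatives (t d/dt) log, on
    which Newton's identities make the Todd map act linearly, coefficient by
    coefficient; two series with the same logarithmic derivative and constant
    term coincide. *)

(** * Logarithmic derivatives of rational power series *)

Section EulerOperator.
Implicit Types f g h : {fps rat}.

Lemma fps_unit0 f : (f \is a GRing.unit) = (f 0%N != 0).
Proof. by rewrite fps_unitE unitfE. Qed.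

Lemma fps_eulerE f n : fps_euler f n = f n *+ n. Proof. by []. Qed.

Lemma fps_dlogP f : f 0%N != 0 -> fps_euler f = f * fps_dlog f.
Proof. by move=> f0; rewrite mulrC divrK // fps_unit0. Qed.

Lemma fpsM_trunc f h n : h 0%N = 0 -> (f * h) n = \sum_(i < n) f i * h (n - i)%N.
Proof. by move=> h0; rewrite fpsME big_ord_recr /= subnn h0 mulr0 addr0. Qed.

(** As [h] has no constant term and n+1 is invertible in [rat], the equation determines coefficient
    n+1 from the earlier ones. *)
Lemma fps_euler_unique f g h : f 0%N = g 0%N -> h 0%N = 0 ->
  fps_euler f = f * h -> fps_euler g = g * h -> f = g.
Proof.
move=> fg0 h0 Ef Eg; apply/fpsP; elim/ltn_ind => -[//|n] IH.
have step (u : {fps rat}) : fps_euler u = u * h ->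
    u n.+1 *+ n.+1 = \sum_(i < n.+1) u i * h (n.+1 - i)%N.
  move=> /(congr1 (fun w : {fps rat} => w n.+1)).
  by rewrite fps_eulerE fpsM_trunc.
apply: (@mulIf _ n.+1%:R); first by rewrite pnatr_eq0.
rewrite !mulr_natr step // [RHS]step //.
by apply: eq_bigr => i _; rewrite IH.
Qed.

Lemma fps_dlog0 f : fps_dlog f 0%N = 0.
Proof. by rewrite fpsM0 fps_eulerE mulr0n mul0r. Qed.

Lemma fps_dlog_eq f h : f 0%N != 0 -> fps_euler f = f * h -> fps_dlog f = h.
Proof. by move=> f0 E; rewrite /fps_dlog E mulrC mulrA mulVr ?mul1r // fps_unit0. Qed.

Lemma fps_dlogM f g : f 0%N != 0 -> g 0%N != 0 ->
  fps_dlog (f * g) = fps_dlog f + fps_dlog g.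
Proof.
move=> f0 g0; apply: fps_dlog_eq; first by rewrite fpsM0 mulf_neq0.
by rewrite fps_eulerM (fps_dlogP f0) (fps_dlogP g0); ring.
Qed.

Lemma fps_dlog1 : fps_dlog 1 = 0.
Proof.
apply: fps_dlog_eq; first by rewrite fps1E oner_neq0.
by rewrite mulr0; apply/fpsP => -[|n]; rewrite fps_eulerE fps1E fps0E ?mulr0n ?mul0rn.
Qed.

Lemma fps_prod_neq0 (I : eqType) (s : seq I) (F : I -> {fps rat}) :
  (forall i, i \in s -> F i 0%N != 0) -> (\prod_(i <- s) F i) 0%N != 0.
Proof.
move=> F0; rewrite big_seq; elim/big_rec: _ => [|i f si f0].
  by rewrite fps1E oner_neq0.
by rewrite fpsM0 mulf_neq0 ?F0.
Qed.

Lemma fps_dlog_prod (I : eqType) (s : seq I) (F : I -> {fps rat}) :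
  (forall i, i \in s -> F i 0%N != 0) ->
  fps_dlog (\prod_(i <- s) F i) = \sum_(i <- s) fps_dlog (F i).
Proof.
elim: s => [|i s IH] F0; first by rewrite !big_nil fps_dlog1.
have F0' j : j \in s -> F j 0%N != 0 by move=> js; rewrite F0 // inE js orbT.
by rewrite !big_cons fps_dlogM ?F0 ?mem_head ?fps_prod_neq0 // IH.
Qed.

Lemma fps_dlogX f k : f 0%N != 0 -> fps_dlog (f ^+ k) = fps_dlog f *+ k.
Proof.
move=> f0.
have fk0 j : (f ^+ j) 0%N != 0.
  by elim: j => [|j IH]; rewrite ?expr0 ?oner_neq0 // exprS fpsM0 mulf_neq0.
elim: k => [|k IH]; first by rewrite expr0 fps_dlog1 mulr0n.
by rewrite exprS mulrS fps_dlogM // IH.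
Qed.

Lemma fpsX_inj : injective (fun f : {fps rat} => f * fpsX).
Proof.
move=> f g /= E; apply/fpsP => n.
by have := congr1 (fun w : {fps rat} => w n.+1) E; rewrite !fpsMX.
Qed.

(** Cancelling common powers of t would leave a vanishing constant term if [a] and [b] differed. *)
Lemma fpsX_valuation f g a b : f 0%N != 0 -> g 0%N != 0 ->
  f * fpsX ^+ a = g * fpsX ^+ b -> f = g.
Proof.
move=> f0 g0; elim: a b => [|a IH] [|b].
- by rewrite !expr0 !mulr1.
- rewrite expr0 mulr1 exprSr mulrA => E.
  by move: f0; rewrite E fpsMX eqxx.
- rewrite expr0 mulr1 exprSr mulrA => E.
  by move: g0; rewrite -E fpsMX eqxx.
- by rewrite !exprSr !mulrA => /fpsX_inj; apply: IH.
Qed.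

End EulerOperator.

(** * Rescaling t, constant series and exponentials *)

Section Substitution.
Implicit Types (a b : rat) (f g : {fps rat}).

Definition fps_scale a f : {fps rat} := Fps (fun n => a ^+ n * f n).

Lemma fps_scaleE a f n : fps_scale a f n = a ^+ n * f n. Proof. by []. Qed.

Lemma fps_scale_coef0 a f : fps_scale a f 0%N = f 0%N.
Proof. by rewrite fps_scaleE expr0 mul1r. Qed.

Lemma fps_scaleM a f g : fps_scale a (f * g) = fps_scale a f * fps_scale a g.
Proof.
apply/fpsP => n; rewrite fps_scaleE !fpsME mulr_sumr; apply: eq_bigr => i _ /=.
by rewrite mulrACA -exprD subnKC // -ltnS.
Qed.

Lemma fps_dlog_scale a f : f 0%N != 0 ->
  fps_dlog (fps_scale a f) = fps_scale a (fps_dlog f).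
Proof.
move=> f0; apply: fps_dlog_eq; first by rewrite fps_scale_coef0.
rewrite -fps_scaleM -fps_dlogP //.
by apply/fpsP => n; rewrite fps_eulerE !fps_scaleE mulrnAr.
Qed.

(** Made a ring morphism below, so that polynomials in q can be evaluated at a power series. *)
Definition fpsC a : {fps rat} := Fps (fun n => a *+ (n == 0)).

Lemma fpsCM a f n : (fpsC a * f) n = a * f n.
Proof.
rewrite fpsME big_ord_recl /= subn0 big1 ?addr0 // => i _.
by rewrite mul0r.
Qed.

Fact fpsC_additive : zmod_morphism fpsC.
Proof. by move=> a b; apply/fpsP => n /=; rewrite mulrnBl. Qed.
Fact fpsC_multiplicative : monoid_morphism fpsC.
Proof.
split; first by apply/fpsP.
by move=> a b; apply/fpsP => n; rewrite fpsCM /= mulrnAr.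
Qed.
HB.instance Definition _ := GRing.isZmodMorphism.Build rat {fps rat} fpsC fpsC_additive.
HB.instance Definition _ :=
  GRing.isMonoidMorphism.Build rat {fps rat} fpsC fpsC_multiplicative.

Lemma fps_dlogC a : a != 0 -> fps_dlog (fpsC a) = 0.
Proof.
move=> a0; apply: fps_dlog_eq => //; rewrite mulr0.
by apply/fpsP => -[|n]; rewrite fps_eulerE /= ?mul0rn.
Qed.

Definition fps_exp a : {fps rat} := Fps (fun n => a ^+ n / n`!%:R).

Lemma fps_exp_coef0 a : fps_exp a 0%N = 1.
Proof. by rewrite /= expr0 divr1. Qed.

Lemma fps_euler_exp a : fps_euler (fps_exp a) = fps_exp a * (fpsC a * fpsX).
Proof.
apply/fpsP => n; rewrite fps_eulerE mulrCA fpsCM fpsMX.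
case: n => [|n]; first by rewrite mulr0n mulr0.
rewrite /= factS natrM exprS -mulr_natr.
have f0 : n`!%:R != 0 :> rat by rewrite pnatr_eq0 -lt0n fact_gt0.
have n0 : n.+1%:R != 0 :> rat by rewrite pnatr_eq0.
by field; rewrite f0 addrC natr1 n0.
Qed.

Lemma fps_dlog_exp a : fps_dlog (fps_exp a) = fpsC a * fpsX.
Proof. by apply: fps_dlog_eq (fps_euler_exp a); rewrite fps_exp_coef0 oner_neq0. Qed.

Lemma fps_expD a b : fps_exp (a + b) = fps_exp a * fps_exp b.
Proof.
apply: (@fps_euler_unique _ _ (fpsC (a + b) * fpsX)).
- by rewrite fpsM0 !fps_exp_coef0 mulr1.
- by rewrite fpsCM mulr0.
- exact: fps_euler_exp.
- by rewrite fps_eulerM !fps_euler_exp rmorphD /=; ring.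
Qed.

Lemma fps_exp0 : fps_exp 0 = 1.
Proof. by apply/fpsP => -[|n]; rewrite /= ?expr0 ?divr1 // expr0n mul0r. Qed.

Lemma fps_expX a k : fps_exp a ^+ k = fps_exp (a *+ k).
Proof.
by elim: k => [|k IH]; rewrite ?expr0 ?fps_exp0 // exprS mulrS fps_expD IH.
Qed.

End Substitution.

(** * The Todd map on series and its logarithmic derivative *)

Section ToddGeneratingSeries.

Lemma psum_symmetric N k : psum N k \is symmetric.
Proof.
apply/issymP => s; rewrite -[LHS]comp_mpoly_id msym_mPo /psum raddf_sum /=.
rewrite [RHS](reindex_inj (@perm_inj _ s)); apply: eq_bigr => j _.
by rewrite rmorphXn /= comp_mpolyXU -tnth_nth !tnth_mktuple.
Qed.

Definition todd_gen (c : {fps rat}) : {fps rat} :=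
  Fps (fun n => (todd n).@[fun i : 'I_n => c i.+1]).

(* The k-th coefficients of dlog c and dlog (todd_gen c) are (-1)^(k-1) p_k and
   tau_k p_k, where p_k is the power sum attached to the "elementary symmetric
   functions" c and tau = dlog (t / (1 - e^-t)). *)
Definition todd_dlog (g : {fps rat}) : {fps rat} :=
  Fps (fun k => fps_dlog todd_series k * (-1) ^+ k.-1 * g k).

Lemma todd_dlogE g k :
  todd_dlog g k = fps_dlog todd_series k * (-1) ^+ k.-1 * g k.
Proof. by []. Qed.

(** With no variables x_j the product characterising Td_0 is empty, so Td_0 = 1. *)
Lemma todd_gen_coef0 c : todd_gen c 0%N = 1.
Proof.
have E := @toddP 0 0; rewrite big_ord0 fps1E in E.
have -> : todd_gen c 0%N = (todd 0).@[fun=> 0] by apply: meval_eq => -[].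
transitivity ((todd 0 \mPo elem_sym 0 0).@[fun i : 'I_0 => 0]).
  by rewrite comp_mpoly_meval; apply: meval_eq => -[].
by rewrite E meval1.
Qed.

(** A formal stand-in for e_i among M free variables: e_0 = 1, and e_i = 0 beyond M. *)
Definition elem_var M i : {mpoly rat[M]} :=
  if i is j.+1 then (if insub j is Some k then 'X_k else 0) else 1.
Arguments elem_var : simpl never.

Section Truncated.
Variables (M : nat) (c : {fps rat}).
Hypothesis c0 : c 0%N = 1.

Let cv (i : 'I_M) := c i.+1.

(** The power sum p_k as a polynomial in the elementary symmetric polynomials. *)
Let P_ k : {mpoly rat[M]} := sval (sym_fundamental (psum_symmetric M k)).
Let P_E k : P_ k \mPo elem_sym M M = psum M k.
Proof. exact: (svalP (sym_fundamental (psum_symmetric M k))).1. Qed.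

Let X_ := elem_var M.

Let X_E i : (i <= M)%N -> X_ i \mPo elem_sym M M = mesym M rat i.
Proof.
case: i => [|i] iM; first by rewrite comp_mpoly1 mesym0E.
by rewrite /X_ /elem_var insubT comp_mpolyXU -tnth_nth tnth_mktuple.
Qed.

Let ev_X i : (i <= M)%N -> (X_ i).@[cv] = c i.
Proof.
case: i => [|i] iM; first by rewrite meval1 c0.
by rewrite /X_ /elem_var insubT mevalXU.
Qed.

(** Moves all Td_k with k at most M into one ring, where they can be compared. *)
Let T_ k : {mpoly rat[M]} := todd k \mPo [tuple X_ i.+1 | i < k].

Let T_E k : (k <= M)%N ->
  T_ k \mPo elem_sym M M = (\prod_(j < M) fps_dilate 'X_j todd_series) k.
Proof.
move=> kM; rewrite -toddP /T_ ![todd k \mPo _]comp_mpolyEX raddf_sum /=.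
apply: eq_bigr => u _; rewrite comp_mpolyZ !comp_mpolyX rmorph_prod /=; congr (_ *: _).
apply: eq_bigr => i _; rewrite rmorphXn /= !tnth_mktuple -/(X_ i.+1).
by rewrite (X_E (leq_trans (ltn_ord i) kM)).
Qed.

Let ev_T k : (k <= M)%N -> (T_ k).@[cv] = todd_gen c k.
Proof.
move=> kM; rewrite /T_ comp_mpoly_meval; apply: meval_eq => i.
by rewrite tnth_mktuple -ev_X // (leq_trans _ kM).
Qed.

(** Newton's identity holds for symmetric polynomials in M variables. Algebraic independence of the
    e_i ([msym_fundamental_un]) lifts it to free variables, which are then evaluated at [c]. *)
Let newton k : (k <= M)%N ->
  c k *+ k = \sum_(i < k) c i * (fps_dlog (1 + fpsX) (k - i)%N * (P_ (k - i)%N).@[cv]).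
Proof.
move=> kM.
have -> : c k *+ k = (X_ k *+ k).@[cv] by rewrite mevalMn ev_X.
have -> : X_ k *+ k = \sum_(i < k) fps_dlog (1 + fpsX) (k - i)%N *: (X_ i * P_ (k - i)%N).
  apply: msym_fundamental_un; rewrite comp_mpolyMn X_E // mesym_rec raddf_sum.
  apply: eq_bigr => i _; rewrite /= comp_mpolyZ rmorphM /= P_E X_E //.
  by rewrite ltnW // (leq_trans _ kM).
rewrite raddf_sum; apply: eq_bigr => i _ /=.
rewrite mevalZ mevalM ev_X 1?mulrCA //.
by rewrite ltnW // (leq_trans _ kM).
Qed.

(** The same lifting, applied to the recursion [prod_dilate_rec] for the Todd product. *)
Let todd_newton k : (k <= M)%N ->
  todd_gen c k *+ k =
  \sum_(i < k) todd_gen c i * (fps_dlog todd_series (k - i)%N * (P_ (k - i)%N).@[cv]).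
Proof.
move=> kM.
have -> : todd_gen c k *+ k = (T_ k *+ k).@[cv] by rewrite mevalMn ev_T.
have -> : T_ k *+ k = \sum_(i < k) fps_dlog todd_series (k - i)%N *: (T_ i * P_ (k - i)%N).
  apply: msym_fundamental_un; rewrite comp_mpolyMn T_E //.
  rewrite prod_dilate_rec ?todd_series0 // raddf_sum.
  apply: eq_bigr => i _; rewrite /= comp_mpolyZ rmorphM /= P_E T_E //.
  by rewrite ltnW // (leq_trans _ kM).
rewrite raddf_sum; apply: eq_bigr => i _ /=.
rewrite mevalZ mevalM ev_T 1?mulrCA //.
by rewrite ltnW // (leq_trans _ kM).
Qed.

(** Newton's recursion and the one from t c' = c dlog c have the same shape; since c_0 = 1, the top
    term of each is isolated and induction applies. *)
Let dlog_psum k : (0 < k <= M)%N ->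
  fps_dlog c k = fps_dlog (1 + fpsX) k * (P_ k).@[cv].
Proof.
elim/ltn_ind: k => -[//|k] IH /andP[_ kM].
have := newton kM.
rewrite -fps_eulerE fps_dlogP ?c0 ?oner_neq0 // fpsM_trunc ?fps_dlog0 //.
rewrite !big_ord_recl [nat_of_ord ord0]/= subn0 c0 !mul1r.
set s1 := \sum_(i < k) _; set s2 := \sum_(i < k) _.
have -> : s1 = s2.
  apply: eq_bigr => i _; rewrite IH //.
    by rewrite lift0 subSS ltnS leq_subr.
  rewrite lift0 subSS subn_gt0 ltn_ord /=.
  by rewrite (leq_trans (leq_subr _ _)) // ltnW.
exact: addIr.
Qed.

Lemma todd_gen_rec :
  fps_euler (todd_gen c) M = (todd_gen c * todd_dlog (fps_dlog c)) M.
Proof.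
rewrite fps_eulerE todd_newton // fpsM_trunc; last by rewrite todd_dlogE fps_dlog0 !mul0r.
apply: eq_bigr => i _; congr (_ * _); rewrite todd_dlogE.
(* The index is positive, so the sign in [todd_dlog] cancels the coefficient of dlog (1 + t). *)
have : (0 < M - i <= M)%N by rewrite subn_gt0 ltn_ord leq_subr.
case: (M - i)%N => [//|k] kM; rewrite succnK.
rewrite dlog_psum // fps_dlog_1X mulrA; congr (_ * _).
by rewrite -mulrA -expr2 sqrr_sign mulr1.
Qed.

End Truncated.

Lemma fps_euler_todd_gen (c : {fps rat}) : c 0%N = 1 ->
  fps_euler (todd_gen c) = todd_gen c * todd_dlog (fps_dlog c).
Proof. by move=> c0; apply/fpsP => n; apply: todd_gen_rec. Qed.

Fact todd_dlog_is_additive : zmod_morphism todd_dlog.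
Proof. by move=> f g; apply/fpsP => n; rewrite fpsDE fpsNE -!mulrBr. Qed.
HB.instance Definition _ :=
  GRing.isZmodMorphism.Build {fps rat} {fps rat} todd_dlog todd_dlog_is_additive.

(** The signs of dlog (1 + at) cancel those in [todd_dlog]; this is the passage from 1 + at to
    T(at). *)
Lemma todd_dlog_linear a :
  todd_dlog (fps_dlog (1 + fpsC a * fpsX)) = fps_scale a (fps_dlog todd_series).
Proof.
have -> : 1 + fpsC a * fpsX = fps_scale a (1 + fpsX).
  by apply/fpsP => -[|[|n]]; rewrite fpsDE fpsCM fps_scaleE fpsDE fps1E /=;
    rewrite ?expr0 ?expr1 ?mulr0 ?addr0 ?mul1r ?add0r ?mulr1 ?mulr0.
rewrite fps_dlog_scale; last by rewrite fpsDE fps1E addr0 oner_neq0.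
apply/fpsP => -[|k].
  by rewrite todd_dlogE !fps_scaleE !fps_dlog0 !mulr0.
rewrite todd_dlogE succnK !fps_scaleE fps_dlog_1X mulrACA.
by rewrite -expr2 sqrr_sign mulr1 mulrC.
Qed.

Lemma scale_todd_series a :
  fps_scale a todd_series * (1 - fps_exp (- a)) = fpsC a * fpsX.
Proof.
have -> : 1 - fps_exp (- a) = fps_scale a (1 - fps_expN).
  apply/fpsP => n; rewrite fps_scaleE !fpsDE !fpsNE mulrDr mulrN !fps1E /=.
  rewrite mulrA -exprMn mulrN1; congr (_ - _).
  by case: n => [|n]; rewrite ?mulr0 // expr0 mulr1.
rewrite -fps_scaleM todd_seriesE; apply/fpsP => n; rewrite fpsCM fps_scaleE /=.
by case: n => [|[|n]]; rewrite ?mulr0.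
Qed.

Lemma fps_scale1 (f : {fps rat}) : fps_scale 1 f = f.
Proof. by apply/fpsP => n; rewrite fps_scaleE expr1n mul1r. Qed.

Lemma todd_series_reflect : todd_series = fps_scale (-1) todd_series * fps_exp 1.
Proof.
have H1 := scale_todd_series 1; have H2 := scale_todd_series (-1).
rewrite fps_scale1 rmorph1 mul1r in H1; rewrite opprK rmorphN1 mulN1r in H2.
have He : fps_exp 1 * fps_exp (-1) = 1 by rewrite -fps_expD subrr fps_exp0.
(* Multiply by t, written as -T(-t)(1 - e^t) on the left and T(t)(1 - e^-t) on the right; both sides
   become T(t) T(-t) (e^t - 1). *)
apply: fpsX_inj => /=.
rewrite -[X in _ * X = _]opprK -H2 -{}[in RHS]H1.
set T := todd_series; set T' := fps_scale _ _; set e := fps_exp 1 in He *.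
have -> : T' * e * (T * (1 - fps_exp (-1))) = T' * T * (e - e * fps_exp (-1)) by ring.
by rewrite He; ring.
Qed.

Lemma dlog_todd_odd_part :
  fps_dlog todd_series - fps_scale (-1) (fps_dlog todd_series) = fpsX.
Proof.
have T0 : todd_series 0%N != 0 by rewrite todd_series0 oner_neq0.
rewrite {1}todd_series_reflect fps_dlogM ?fps_scale_coef0 ?fps_exp_coef0 ?oner_neq0 //.
by rewrite fps_dlog_scale // fps_dlog_exp rmorph1 mul1r addrC addKr.
Qed.

End ToddGeneratingSeries.

(** * The exponential generating series of the power sums of the m_i *)

Section PowerSums.
Variables (r : nat) (m : 'I_r -> nat) (Vp Vm : seq nat).
Hypothesis mE : let q : {fraction {poly rat}} := FracField.tofrac 'X in
  \sum_(i < r) q ^+ m i =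
  q * (\prod_(v <- Vp) (1 - q ^+ v)) / \prod_(v <- Vm) (1 - q ^+ v).
Hypothesis Vp_gt0 : forall v, v \in Vp -> (0 < v)%N.
Hypothesis Vm_gt0 : forall v, v \in Vm -> (0 < v)%N.

Lemma sub1Xn_neq0 v : (0 < v)%N -> 1 - 'X^v != 0 :> {poly rat}.
Proof.
move=> v0; apply/eqP => /(congr1 (fun P : {poly rat} => P.[0])).
rewrite !hornerE expr0n eqn0Ngt v0 subr0 => /eqP.
by rewrite oner_eq0.
Qed.

(** Denominators are cleared before substituting q = e^t, because 1 - e^(vt) has constant term 0 and
    is not invertible. *)
Lemma exponent_poly_identity :
  (\sum_(i < r) 'X^(m i)) * \prod_(v <- Vm) (1 - 'X^v) =
  'X * \prod_(v <- Vp) (1 - 'X^v) :> {poly rat}.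
Proof.
have prodE V : \prod_(v <- V) (1 - (FracField.tofrac 'X : {fraction {poly rat}}) ^+ v) =
    FracField.tofrac (\prod_(v <- V) (1 - 'X^v)).
  rewrite rmorph_prod; apply: eq_bigr => v _.
  by rewrite rmorphB rmorph1 rmorphXn.
apply/eqP; rewrite -tofrac_eq !rmorphM /= rmorph_sum /= -!prodE; apply/eqP.
under eq_bigr do rewrite rmorphXn.
rewrite [X in X * _](mE : _ = _) divfK // prodE tofrac_eq0.
rewrite prodf_seq_neq0; apply/allP => v vV /=.
exact: sub1Xn_neq0 (Vm_gt0 vV).
Qed.

Definition exp_sum : {fps rat} := \sum_(i < r) fps_exp (m i)%:R.

Lemma exp_sum_identity :
  exp_sum * \prod_(v <- Vm) (1 - fps_exp v%:R) =
  fps_exp 1 * \prod_(v <- Vp) (1 - fps_exp v%:R).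
Proof.
have ce : commr_rmorph fpsC (fps_exp 1) by move=> a; apply: mulrC.
(* The substitution q = e^t as a ring morphism. *)
pose phi : {rmorphism {poly rat} -> {fps rat}} := horner_morph ce.
have phiX k : phi 'X^k = fps_exp k%:R.
  by rewrite rmorphXn /= horner_morphX fps_expX.
have phi_prod V : phi (\prod_(v <- V) (1 - 'X^v)) = \prod_(v <- V) (1 - fps_exp v%:R).
  rewrite rmorph_prod; apply: eq_bigr => v _.
  by rewrite rmorphB rmorph1 phiX.
have := congr1 phi exponent_poly_identity.
rewrite !rmorphM !phi_prod rmorph_sum -['X]expr1 phiX => <-.
by congr (_ * _); apply: eq_bigr => i _; rewrite phiX.
Qed.

Let T v := fps_scale (- v%:R) todd_series.

Let T0 v : T v 0%N != 0.
Proof. by rewrite fps_scale_coef0 todd_series0 oner_neq0. Qed.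

Let T_prod V : \prod_(v <- V) (1 - fps_exp v%:R) * \prod_(v <- V) T v =
  fpsC (\prod_(v <- V) - v%:R) * fpsX ^+ size V.
Proof.
rewrite -big_split /=; elim: V => [|v V IH].
  by rewrite !big_nil rmorph1 mulr1.
rewrite !big_cons IH rmorphM /= exprS [RHS]mulrACA; congr (_ * _).
by rewrite mulrC -(scale_todd_series (- v%:R)) opprK.
Qed.

Lemma exp_sum_coef0 : exp_sum 0%N = r%:R.
Proof.
rewrite fps_sumE; under eq_bigr do rewrite fps_exp_coef0.
by rewrite sumr_const card_ord.
Qed.

Lemma dlog_exp_sum : (0 < r)%N ->
  fps_dlog exp_sum = fpsX
    + \sum_(v <- Vm) fps_scale (- v%:R) (fps_dlog todd_series)
    - \sum_(v <- Vp) fps_scale (- v%:R) (fps_dlog todd_series).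
Proof.
move=> r0; have S0 : exp_sum 0%N != 0 by rewrite exp_sum_coef0 pnatr_eq0 -lt0n.
pose cm := \prod_(v <- Vm) - v%:R : rat; pose cp := \prod_(v <- Vp) - v%:R : rat.
have c_neq0 (V : seq nat) : (forall v, v \in V -> (0 < v)%N) ->
    \prod_(v <- V) - v%:R != 0 :> rat.
  move=> V0; rewrite prodf_seq_neq0; apply/allP => v /V0 v0 /=.
  by rewrite oppr_eq0 pnatr_eq0 -lt0n.
have cm0 : fpsC cm 0%N != 0 by apply: c_neq0.
have cp0 : fpsC cp 0%N != 0 by apply: c_neq0.
have PT0 V : (\prod_(v <- V) T v) 0%N != 0 by apply: fps_prod_neq0.
have e0 : fps_exp 1 0%N != 0 by rewrite fps_exp_coef0 oner_neq0.
have : exp_sum * \prod_(v <- Vp) T v * fpsC cm = fps_exp 1 * \prod_(v <- Vm) T v * fpsC cp.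
  apply: (@fpsX_valuation _ _ (size Vm) (size Vp)); rewrite ?fpsM0 ?mulf_neq0 //.
  rewrite -!mulrA -!T_prod.
  set A := \prod_(v <- Vm) T v; set B := \prod_(v <- Vp) T v.
  have := exp_sum_identity; set C := \prod_(v <- Vm) _; set D := \prod_(v <- Vp) _ => E.
  have -> : exp_sum * (B * (C * A)) = (exp_sum * C) * (A * B) by ring.
  by rewrite E; ring.
move=> /(congr1 fps_dlog).
rewrite !fps_dlogM ?fpsM0 ?mulf_neq0 // !fps_dlogC // !addr0.
rewrite !fps_dlog_prod // fps_dlog_exp rmorph1 mul1r.
under eq_bigr do rewrite fps_dlog_scale ?todd_series0 ?oner_neq0 //.
under [in RHS]eq_bigr do rewrite fps_dlog_scale ?todd_series0 ?oner_neq0 //.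
by move=> <-; rewrite addrK.
Qed.

End PowerSums.

(** * The Todd map on the factors of gamma, and the conclusion *)

Lemma todd_dlog_prod (V : seq nat) :
  todd_dlog (fps_dlog (\prod_(v <- V) (1 - v%:R * fpsX))) =
  \sum_(v <- V) fps_scale (- v%:R) (fps_dlog todd_series).
Proof.
rewrite fps_dlog_prod => [|v _]; last first.
  by rewrite fpsDE fpsNE fpsM0 mulr0 subr0 oner_neq0.
rewrite raddf_sum; apply: eq_bigr => v _.
by rewrite /= -todd_dlog_linear rmorphN mulNr rmorph_nat.
Qed.

(** Coefficientwise, p times the unknown is p^k (t_k - (-1)^k t_k) with t_k the coefficients of dlog
    T. By [dlog_todd_odd_part] this is p at k = 1 and 0 elsewhere, so the root behaves like e^t. *)
Lemma todd_dlog_root p (rho : {fps rat}) : (0 < p)%N -> rho 0%N = 1 ->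
  rho ^+ p = (1 + p%:R * fpsX) / (1 - p%:R * fpsX) ->
  todd_dlog (fps_dlog rho) = fpsX.
Proof.
move=> p0 rho0 rhoE.
have c1 (a : {fps rat}) : (1 + a * fpsX) 0%N != 0.
  by rewrite fpsDE fpsM0 mulr0 addr0 oner_neq0.
have c1' : (1 - p%:R * fpsX : {fps rat}) 0%N != 0 by rewrite -mulNr.
have R0 : rho 0%N != 0 by rewrite rho0 oner_neq0.
have Rp0 : (rho ^+ p) 0%N != 0 by rewrite -fps_unit0 unitrX // fps_unit0.
have E : rho ^+ p * (1 - p%:R * fpsX) = 1 + p%:R * fpsX.
  by rewrite rhoE divrK // fps_unit0.
have := congr1 (fun f => todd_dlog (fps_dlog f)) E.
rewrite /= fps_dlogM // fps_dlogX // raddfD raddfMn /=.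
have -> : 1 + p%:R * fpsX = 1 + fpsC p%:R * fpsX :> {fps rat} by rewrite rmorph_nat.
have -> : 1 - p%:R * fpsX = 1 + fpsC (- p%:R) * fpsX :> {fps rat}.
  by rewrite rmorphN rmorph_nat mulNr.
rewrite !todd_dlog_linear => H; apply/fpsP => k.
have {}H := congr1 (fun f : {fps rat} => f k) H.
have O := congr1 (fun f : {fps rat} => f k) dlog_todd_odd_part.
move: H O; rewrite !fpsDE fpsNE !fps_scaleE.
have -> : (todd_dlog (fps_dlog rho) *+ p) k = todd_dlog (fps_dlog rho) k *+ p.
  by elim: (p) => [|q IH]; rewrite ?mulr0n // !mulrSr fpsDE IH.
move: (todd_dlog _ k) (fps_dlog todd_series k) => x t H O.
have pn0 : p%:R != 0 :> rat by rewrite pnatr_eq0 -lt0n.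
apply: (mulIf pn0).
have -> : x * p%:R = p%:R ^+ k * (t - (-1) ^+ k * t).
  by rewrite mulr_natr -[LHS](addrK ((- p%:R) ^+ k * t)) H -[- p%:R]mulN1r exprMn; ring.
rewrite O; case: k {H O} => [|[|k]]; rewrite /= ?mulr0 ?mul0r ?expr1 ?mulr1 ?mul1r //.
Qed.

Theorem theorem3p3 (r : nat) (m : 'I_r -> nat)
  (m_le : forall i j : 'I_r, (i <= j)%N -> (m i <= m j)%N)
  (m_gt0 : forall i, (0 < m i)%N)
  (Vp Vm : seq nat)
  (Vp_gt0 : forall v, v \in Vp -> (0 < v)%N)
  (Vm_gt0 : forall v, v \in Vm -> (0 < v)%N)
  (mE : let q : {fraction {poly rat}} := FracField.tofrac 'X in
    \sum_(i < r) q ^+ m i =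
    q * (\prod_(v <- Vp) (1 - q ^+ v)) / \prod_(v <- Vm) (1 - q ^+ v))
  (p : nat) (p_gt0 : (0 < p)%N)
  (rho : {fps rat}) (rho0 : rho 0%N = 1)
  (rhoE : rho ^+ p = (1 + p%:R * fpsX) / (1 - p%:R * fpsX))
  (gamma : nat -> rat)
  (gammaE : Fps gamma =
    (\prod_(v <- Vm) (1 - v%:R * fpsX)) / (\prod_(v <- Vp) (1 - v%:R * fpsX)) * rho)
  (n : nat) :
  \sum_(i < r) (m i)%:R ^+ n =
  n`!%:R * r%:R * (todd n).@[fun i : 'I_n => gamma i.+1].
Proof.
(* For r = 0 both sides vanish; otherwise [exp_sum] has a nonzero constant term and so a logarithmic
   derivative. *)
have [r0|r0] := posnP r.
  rewrite [X in _ * X%:R * _]r0 mulr0 mul0r big1 // => i.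
  by move: (ltn_ord i); rewrite [X in (_ < X)%N]r0.
have rho_neq0 : rho 0%N != 0 by rewrite rho0 oner_neq0.
have P0 (V : seq nat) : (\prod_(v <- V) (1 - v%:R * fpsX : {fps rat})) 0%N = 1.
  elim: V => [|v V IH]; first by rewrite big_nil.
  by rewrite big_cons fpsM0 IH fpsDE fpsNE fpsM0 mulr0 subr0 mulr1.
have P_neq0 V : (\prod_(v <- V) (1 - v%:R * fpsX : {fps rat})) 0%N != 0.
  by rewrite P0 oner_neq0.
set c := Fps gamma in gammaE.
have cE : c * \prod_(v <- Vp) (1 - v%:R * fpsX) = (\prod_(v <- Vm) (1 - v%:R * fpsX)) * rho.
  by rewrite gammaE mulrAC divrK // fps_unit0.
have c0 : c 0%N = 1.
  have := congr1 (fun f : {fps rat} => f 0%N) cE.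
  by rewrite !fpsM0 !P0 rho0 !mulr1.
have c_neq0 : c 0%N != 0 by rewrite c0 oner_neq0.
have dlog_c : todd_dlog (fps_dlog c) = fps_dlog (exp_sum m).
  rewrite (dlog_exp_sum mE Vp_gt0 Vm_gt0 r0) -!todd_dlog_prod.
  have := congr1 (fun f => todd_dlog (fps_dlog f)) cE.
  rewrite /= !fps_dlogM // !raddfD /= (todd_dlog_root p_gt0 rho0 rhoE) => E.
  by rewrite [fpsX + _]addrC -E addrK.
have S0 : exp_sum m 0%N != 0 by rewrite exp_sum_coef0 pnatr_eq0 -lt0n.
(* Both series have constant term r and the same logarithmic derivative; comparing coefficients of
   t^n gives the claim up to the factor n!. *)
have /(congr1 (fun f : {fps rat} => f n)) : exp_sum m = fpsC r%:R * todd_gen c.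
  apply: (@fps_euler_unique _ _ (fps_dlog (exp_sum m))).
  - by rewrite exp_sum_coef0 fpsCM todd_gen_coef0 mulr1.
  - exact: fps_dlog0.
  - exact: fps_dlogP.
  - rewrite -mulrA -dlog_c -fps_euler_todd_gen //.
    by apply/fpsP => k; rewrite fps_eulerE !fpsCM fps_eulerE mulrnAr.
rewrite fpsCM fps_sumE /= -mulr_suml -mulrA => <-.
by rewrite mulrC divfK // pnatr_eq0 -lt0n fact_gt0.
Qed.
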